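(* A point $z_0\in\mathbb C$ is a limit of zeros of $p_n(z)$ (all $n$), i.e. there exist $z_n$ ($n\ge1$) with $p_n(z_n)=0$ and $z_n\to z_0$, if and only if $z_0\in\mathrm{supp}(d\rho)$.
   Context: Let $p\ge 1$ and let $\{a_n\}_{n\ge1}$, $\{b_n\}_{n\ge1}$ be real sequences with $a_n>0$, $a_{n+p}=a_n$, $b_{n+p}=b_n$. The orthonormal polynomials $p_n$ are defined by $p_{-1}\equiv0$, $p_0\equiv1$, $xp_n(x)=a_{n+1}p_{n+1}(x)+b_{n+1}p_n(x)+a_np_{n-1}(x)$ for $n\ge0$ (where $a_0p_{-1}\equiv0$). $d\rho$ is the unique probability measure on $\mathbb R$ for which $\{p_n\}_{n\ge0}$ are orthonormal, i.e. the measure with Jacobi coefficients $\{a_n,b_n\}$. *)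

(* Defs.v *)
From mathcomp Require Export all_boot all_order all_algebra.
From mathcomp Require Export all_classical all_reals all_analysis.
From mathcomp Require Export complex.
Set Implicit Arguments.
Unset Strict Implicit.
Unset Printing Implicit Defensive.
Import Order.TTheory GRing.Theory Num.Theory.
Import numFieldNormedType.Exports.
Local Open Scope classical_set_scope.
Local Open Scope ring_scope.

(* Orthonormal polynomials with Jacobi coefficients (a_n, b_n), n >= 1: the
   recurrence of opoly_rec solved for its leading term. The values a 0 and b 0
   are never used. *)
Fixpoint opoly (R : realType) (a b : nat -> R) (n : nat) : {poly R} :=
  match n with
  | 0 => 1
  | n'.+1 =>
      (a n)^-1 *: (('X - (b n)%:P) * opoly a b n'
                   - (if n' is m.+1 then a n' *: opoly a b m else 0))
  end.

Lemma opoly_rec (R : realType) (a b : nat -> R) (n : nat) :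
  a n.+1 != 0 ->
  'X * opoly a b n =
    a n.+1 *: opoly a b n.+1 + b n.+1 *: opoly a b n
    + (if n is m.+1 then a n *: opoly a b m else 0).
Proof.
move=> an0; rewrite [opoly a b n.+1]/= scalerA divff // scale1r.
by rewrite mulrBl mul_polyC addrAC subrK subrK.
Qed.

(* Integrability is required because the library integral is total. *)
Definition orthonormal_wrt (R : realType)
    (rho : probability (measurableTypeR R) R) (q : nat -> {poly R}) : Prop :=
  forall m n : nat,
    rho.-integrable setT (fun x : R => ((q m).[x] * (q n).[x])%:E) /\
    (\int[rho]_(x in setT) ((q m).[x] * (q n).[x])%:E = ((m == n)%:R : R)%:E)%E.

Definition supp (R : realType)
    (rho : {measure set (measurableTypeR R) -> \bar R}) : set R :=
  [set x | forall U : set R, open_nbhs x U -> (0 < rho U)%E].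

(* Main.v *)
From HB Require Import structures.
Require Import Defs.
From mathcomp Require Import measurable_realfun ring lra zify.
Import Order.TTheory GRing.Theory Num.Theory.
Import numFieldNormedType.Exports.
Local Open Scope classical_set_scope.
Local Open Scope ring_scope.
Local Open Scope complex_scope.

(** Write P n for the n-th orthonormal polynomial and L q for the integral of
    the polynomial q against rho. Periodicity enters through the boundedness of
    the Jacobi coefficients.

    Zeros. If a nonnegative quadratic (X - u)^2 + v^2 divided P n, with cofactor
    s, then s would have degree less than n, so L (P n * s) = 0; but P n * s is
    the quadratic times s^2, and its integral is positive. Hence P n has neither
    non-real zeros (v <> 0) nor multiple ones (v = 0): it has n simple real
    zeros (opoly_split).

    A limit of zeros lies in the support. Let x be a zero of P n and y one of
    P n.+1, and divide: P n = (X - x) q, P n.+1 = (X - y) r. Then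
    (y - x) q r = P n * r - P n.+1 * q, and integrating gives
    a n.+1 * (y - x) * L (q r) = 1 by orthogonality and comparison of leading
    coefficients (opoly_succ_roots_gap). If x and y stay at distance d from the
    support, then d^2 q^2 <= (P n)^2 almost everywhere, so L (q^2) <= 1 / d^2;
    likewise for r, whence |L (q r)| <= 1 / d^2. So d^2 <= a n.+1 * |y - x|
    (consecutive_roots_apart), and consecutive polynomials cannot both have
    zeros arbitrarily close to a point off the support.

    A support point is a limit of zeros. Gauss quadrature shows that a
    polynomial of degree less than 2n which is nonnegative at the zeros of P n
    has a nonnegative integral (functional_ge0_of_roots). The zeros of all P n
    lie in a fixed bounded interval (opoly_root_bound). Suppose P n has no zero
    within e of the support point x0. With T large and g = T^2 - (X - x0)^2, the
    zeros satisfy 0 <= g <= T^2 - e^2, so the quadrature gives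
    L (g^(2k)) <= (T^2 - e^2)^(2k) as soon as n > 2k. On the other hand g is at
    least T^2 - (e/2)^2 on the ball of radius e/2, which has positive mass, and
    this contradicts the upper bound when k is large (supp_near_root). The zero
    of P n nearest to x0 then converges to x0. *)

Set Implicit Arguments.
Unset Strict Implicit.
Unset Printing Implicit Defensive.

(** * The three-term recurrence *)

Section Recurrence.
Variables (R : realType) (a b : nat -> R).
Hypothesis a_gt0 : forall n, 0 < a n.+1.

Lemma size_lead_opoly n :
  (size (opoly a b n) <= n.+1)%N /\ 0 < (opoly a b n)`_n.
Proof.
have [m] := ubnP n; elim: m n => // m IH [|n] ltnm.
  by rewrite /= size_poly1 coef1.
have [sn pn] := IH n ltnm.
have an := a_gt0 n.
set tail := if n is m'.+1 then a n *: opoly a b m' else 0.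
have st : (size tail <= n)%N.
  rewrite /tail; case: (n) ltnm => [|n'] ltnm; first by rewrite size_poly0.
  apply: leq_trans (size_scale_leq _ _) _.
  by have [] := IH n' (ltnW ltnm).
have -> : opoly a b n.+1 =
    (a n.+1)^-1 *: (('X - (b n.+1)%:P) * opoly a b n - tail) by [].
split.
  apply: leq_trans (size_scale_leq _ _) _.
  rewrite (leq_trans (size_polyD _ _))// geq_max size_polyN.
  rewrite (leq_trans st) ?andbT; last by lia.
  rewrite (leq_trans (size_polyMleq _ _))// size_XsubC; lia.
rewrite coefZ coefB mulrBl coefB coefXM /= coefCM.
rewrite (nth_default 0 sn) (nth_default 0 (leqW st)) mulr0 !subr0.
by rewrite mulr_gt0 ?invr_gt0.
Qed.

Lemma coef_opoly_gt0 n : 0 < (opoly a b n)`_n.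
Proof. by have [] := size_lead_opoly n. Qed.

Lemma size_opoly n : size (opoly a b n) = n.+1.
Proof.
have [sn pn] := size_lead_opoly n; apply/eqP; rewrite eqn_leq sn /= ltnNge.
by apply/negP => h; move: pn; rewrite nth_default // ltxx.
Qed.

Lemma opoly_neq0 n : opoly a b n != 0.
Proof. by rewrite -size_poly_eq0 size_opoly. Qed.

Lemma lead_opolyS n :
  a n.+1 * (opoly a b n.+1)`_n.+1 = (opoly a b n)`_n.
Proof.
have an := a_gt0 n.
have sn : (size (opoly a b n) <= n.+1)%N by rewrite size_opoly.
have := opoly_rec b (lt0r_neq0 an).
set tail := if n is m.+1 then a n *: opoly a b m else 0.
have st : (size tail <= n.+1)%N.
  rewrite /tail; case: (n) => [|m]; first by rewrite size_poly0.
  by rewrite (leq_trans (size_scale_leq _ _)) // size_opoly; lia.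
move: (opoly a b n.+1) => q /(congr1 (fun r : {poly R} => r`_n.+1)).
rewrite !coefD !coefZ (nth_default 0 sn) (nth_default 0 st) mulr0 !addr0 => <-.
by rewrite coefXM.
Qed.

Lemma size_sub_opoly k (q : {poly R}) : (size q <= k.+1)%N ->
  (size (q - (q`_k / (opoly a b k)`_k) *: opoly a b k)%R <= k)%N.
Proof.
move=> sq; apply/leq_sizeP => j kj; rewrite coefB coefZ.
have [->|nkj] := eqVneq j k.
  by rewrite divfK ?subrr // lt0r_neq0 // coef_opoly_gt0.
have ltkj : (k < j)%N by rewrite ltn_neqAle eq_sym nkj.
have -> : q`_j = 0 by apply: nth_default; exact: leq_trans sq ltkj.
by rewrite [X in _ * X]nth_default ?mulr0 ?subrr ?size_opoly.
Qed.

(** P 0, ..., P (k - 1) span the polynomials of degree less than k; as an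
    induction principle this serves both for orthogonality relations and for the
    integrability of polynomials. *)
Lemma opoly_span_ind (K : {poly R} -> Prop) k :
  K 0 ->
  (forall c m q, (m < k)%N -> K q -> K (q + c *: opoly a b m)) ->
  forall q : {poly R}, (size q <= k)%N -> K q.
Proof.
elim: k => [|k IH] K0 KD q sq.
  by move: sq; rewrite leqn0 size_poly_eq0 => /eqP->.
rewrite -[q](subrK ((q`_k / (opoly a b k)`_k) *: opoly a b k)).
apply: (KD) => //; apply: IH (size_sub_opoly sq) => // c m r mk.
by apply: KD; exact: ltnW.
Qed.

(** Outside the interval of radius 3A the recurrence makes |P k (x)|
    nondecreasing in k, so P n cannot vanish there. *)
Lemma opoly_root_bound A n x :
  (forall k, a k.+1 <= A) -> (forall k, `|b k.+1| <= A) ->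
  root (opoly a b n) x -> `|x| <= 3 * A.
Proof.
move=> aA bA rx; rewrite leNgt; apply/negP => ltAx.
have grow k : 0 < `|(opoly a b k).[x]| <= `|(opoly a b k.+1).[x]|.
  elim: k => [|k /andP[p0 pk]].
    rewrite /= subr0 mulr1 !hornerE normr1 ltr01/= normrM.
    have a1 := a_gt0 0%N.
    rewrite normfV (gtr0_norm a1) mulrC ler_pdivlMr // mul1r.
    have := aA 0%N; have := bA 0%N; have := lerB_dist x (b 1).
    have := le_trans (ltW a1) (aA 0%N).
    by move: ltAx; clear; move: `|x| `|b 1| => u v; lra.
  rewrite (lt_le_trans p0 pk)/=.
  have a1 := a_gt0 k.+1; have a0 := a_gt0 k.
  have aA1 := aA k.+1; have aA0 := aA k.
  have bA1 := bA k.+1.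
  have e' : a k.+2 * (opoly a b k.+2).[x] =
    (x - b k.+2) * (opoly a b k.+1).[x] - a k.+1 * (opoly a b k).[x].
    have := opoly_rec b (lt0r_neq0 a1).
    move: (opoly a b k.+2) (opoly a b k.+1) (opoly a b k) => s q r.
    by move=> /(congr1 (horner^~ x)); rewrite !hornerE => e; lra.
  rewrite -(ler_pM2l a1) -{2}(gtr0_norm a1) -normrM e'.
  apply: le_trans (lerB_dist _ _); rewrite !normrM (gtr0_norm a0).
  have h1 : 2 * A <= `|x - b k.+2|.
    by have := lerB_dist x (b k.+2); lra.
  have A0 : 0 < A by exact: lt_le_trans a0 aA0.
  have h2 := ler_wpM2r (normr_ge0 (opoly a b k.+1).[x]) h1.
  have h3 := ler_wpM2r (normr_ge0 (opoly a b k.+1).[x]) aA1.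
  have h4 := ler_pM (ltW a0) (ltW p0) aA0 pk.
  lra.
by have /andP[] := grow n; rewrite (rootP rx) normr0 ltxx.
Qed.

End Recurrence.

(** * Zeros and quadrature for a positive functional *)

Section PositiveFunctional.
Variables (R : realType) (a b : nat -> R) (L : {scalar {poly R}}).
Hypothesis a_gt0 : forall n, 0 < a n.+1.
Hypothesis L_sqr_ge0 : forall q : {poly R}, 0 <= L (q ^+ 2).
Hypothesis L_orth : forall m n, L (opoly a b m * opoly a b n) = (m == n)%:R.

Local Notation P := (opoly a b).

(** L (P n * _) sees only the coefficient of degree n, because P n is
    orthogonal to all lower degrees and L (P n * P n) = 1. *)
Lemma functional_opolyM n (q : {poly R}) :
  (size q <= n.+1)%N -> L (P n * q) = q`_n / (P n)`_n.
Proof.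
move=> sq; rewrite -{1}[q](subrK ((q`_n / (P n)`_n) *: P n)) mulrDr linearD.
rewrite -(scalerAr _ (P n) (P n)) scalarZ L_orth eqxx mulr1.
rewrite [X in X + _](_ : _ = 0) ?add0r //.
move: (_ - _) (size_sub_opoly b a_gt0 sq) => r.
apply: (opoly_span_ind (K := fun r => L (P n * r) = 0) (b := b) a_gt0).
  by rewrite mulr0 linear0.
move=> c m {}r mn Lr; rewrite mulrDr linearD Lr add0r.
by rewrite -(scalerAr c (P n)) scalarZ L_orth gtn_eqF // mulr0.
Qed.

Lemma functional_opoly_orth n (q : {poly R}) :
  (size q <= n)%N -> L (P n * q) = 0.
Proof.
move=> sq; rewrite functional_opolyM; last exact: leqW.
by rewrite nth_default ?mul0r.
Qed.

Lemma functional_sqrD c (q r : {poly R}) :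
  L ((q + c *: r) ^+ 2) = L (q ^+ 2) + 2 * c * L (q * r) + c ^+ 2 * L (r ^+ 2).
Proof.
rewrite -!scalarZ -!linearD; congr (L _).
by rewrite -!mul_polyC !rmorphM /=; ring.
Qed.

(** Strict positivity comes from Bessel's inequality L (q^2) >= L (P m * q)^2
    with m the degree of q: the right-hand side is a positive multiple of the
    square of the leading coefficient. *)
Lemma functional_sqr_gt0 (q : {poly R}) : q != 0 -> 0 < L (q ^+ 2).
Proof.
move=> q0; set m := (size q).-1.
have sq : size q = m.+1 by rewrite prednK // size_poly_gt0.
set l := L (P m * q).
have l0 : l != 0.
  rewrite /l functional_opolyM ?sq // mulf_neq0 ?invr_neq0//.
    by rewrite -lead_coefE lead_coef_eq0.
  exact: lt0r_neq0 (coef_opoly_gt0 b a_gt0 m).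
(* q - l P m is the component of q orthogonal to P m. *)
have := L_sqr_ge0 (q + (- l) *: P m).
rewrite functional_sqrD [q * _]mulrC [P m ^+ 2]expr2 -/l L_orth eqxx.
rewrite sqrrN mulr1.
have l2 : 0 < l ^+ 2 by rewrite exprn_even_gt0.
lra.
Qed.

(** The case v = 0 excludes double zeros, the others exclude non-real ones:
    the cofactor s would be orthogonal to P n, although P n * s is a
    nonnegative quadratic times s^2. *)
Lemma sum_sqr_not_dvd_opoly n u v :
  ~~ ((('X - u%:P) ^+ 2 + (v ^+ 2)%:P) %| P n).
Proof.
apply/negP; set d := _ + _ => dvd.
have e := divpK dvd; set s := P n %/ d in e.
have s0 : s != 0.
  by apply: contraNneq (opoly_neq0 b a_gt0 n) => s0; rewrite -e s0 mul0r.
have sd : size d = 3.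
  rewrite /d size_polyDl size_exp_XsubC //.
  by rewrite (leq_ltn_trans (size_polyC_leq1 _)).
have d0 : d != 0 by rewrite -size_poly_eq0 sd.
have ss : (size s <= n)%N.
  by have := size_opoly b a_gt0 n; rewrite -e size_mul // sd addn3 => -[<-].
have := functional_opoly_orth ss.
rewrite -e.
have -> : s * d * s = (('X - u%:P) * s) ^+ 2 + (v ^+ 2) *: s ^+ 2.
  by rewrite /d -mul_polyC; ring.
rewrite linearD /= scalarZ.
have h1 : 0 < L ((('X - u%:P) * s) ^+ 2).
  by apply: functional_sqr_gt0; rewrite mulf_neq0 // polyXsubC_eq0.
have h2 := mulr_ge0 (sqr_ge0 v) (L_sqr_ge0 s).
lra.
Qed.

(** A non-real zero u + iv of P n is also a zero of the quadratic
    (X - u)^2 + v^2; the remainder of P n by it is a real polynomial of degree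
    at most 1 that vanishes at u + iv, hence is 0. *)
Lemma opoly_root_real n (w : R[i]) :
  root (map_poly (real_complex R) (P n)) w ->
  complex.Im w = 0 /\ root (P n) (complex.Re w).
Proof.
case: w => u v /= rw.
have [v0|v0] := eqVneq v 0.
  by split=> //; move: rw; rewrite v0 -[_ +i* _]/(u%:C) fmorph_root.
case/negP: (sum_sqr_not_dvd_opoly n u v).
pose d : {poly R} := ('X - u%:P) ^+ 2 + (v ^+ 2)%:P; rewrite -/d.
have sd : size d = 3.
  rewrite /d size_polyDl size_exp_XsubC //.
  by rewrite (leq_ltn_trans (size_polyC_leq1 _)).
have d0 : d != 0 by rewrite -size_poly_eq0 sd.
have dw : root (map_poly (real_complex R) d) (u +i* v).
  rewrite /d rmorphD rmorphXn rmorphB /= map_polyX !map_polyC /root !hornerE /=.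
  apply/eqP/eqP; rewrite eq_complex /= expr2.
  by apply/andP; split; apply/eqP; ring.
rewrite /dvdp; pose r : {poly R} := P n %% d; rewrite -/r.
have sr : (size r < size d)%N by rewrite [leqLHS]/= ltn_modp.
rewrite sd ltnS in sr.
have : root (map_poly (real_complex R) r) (u +i* v).
  move: rw; rewrite {1}(divp_eq (P n) d) rmorphD rmorphM /= /root.
  by rewrite hornerD hornerM (rootP dw) mulr0 add0r.
have er : r = r`_1 *: 'X + (r`_0)%:P.
  apply/polyP => -[|[|k]];
    rewrite coefD coefZ coefX coefC /= ?mulr0 ?mulr1 ?add0r ?addr0//.
  by rewrite nth_default // (leq_trans sr).
rewrite er rmorphD /= linearZ /= map_polyX map_polyC /root !hornerE /=.
rewrite eq_complex /= !mul0r subr0 !addr0 => /andP[/eqP e1 /eqP e2].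
have r1 : r`_1 = 0.
  by apply/eqP; move/eqP: e2; rewrite mulf_eq0 (negbTE v0) orbF.
by move: e1; rewrite r1 mul0r add0r => ->; rewrite scale0r add0r.
Qed.

Lemma opoly_simple_root n x :
  root (P n) x -> (P n %/ ('X - x%:P)).[x] != 0.
Proof.
move=> rx; apply/negP => /eqP/rootP; rewrite -dvdp_XsubCl => /divpK e.
case/negP: (sum_sqr_not_dvd_opoly n x 0); rewrite expr0n addr0.
have := divpK (_ : 'X - x%:P %| P n); rewrite dvdp_XsubCl => /(_ rx) <-.
by rewrite -e -mulrA -expr2 dvdp_mull.
Qed.

(** The last clause, that P n divides every polynomial vanishing at its
    zeros, is the form in which the simplicity of the zeros is used in the
    quadrature. *)
Lemma opoly_split n : exists xs : seq R,
  [/\ uniq xs, size xs = n, forall x, root (P n) x = (x \in xs) &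
      forall q : {poly R}, all (root q) xs -> P n %| q].
Proof.
have [zs ez] := closed_field_poly_normal (map_poly (real_complex R) (P n)).
have P0 : map_poly (real_complex R) (P n) != 0.
  by rewrite map_poly_eq0; exact: opoly_neq0.
have rzs w : (w \in zs) -> root (map_poly (real_complex R) (P n)) w.
  by move=> wz; rewrite ez rootZ ?lead_coef_eq0 // root_prod_XsubC.
set xs := map (@complex.Re R) zs.
have exs : P n = lead_coef (P n) *: \prod_(x <- xs) ('X - x%:P).
  apply: (map_poly_inj (real_complex R)); rewrite [LHS]ez linearZ /=.
  rewrite lead_coef_map rmorph_prod big_map; congr (_ *: _).
  rewrite !big_seq; apply: eq_bigr => w /rzs/opoly_root_real[w0 _].
  rewrite rmorphB /= map_polyX map_polyC /=.
  by rewrite [in LHS](complexE w) w0 mulr0 addr0.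
have l0 : lead_coef (P n) != 0 by rewrite lead_coef_eq0; exact: opoly_neq0.
exists xs.
have rxs x : root (P n) x = (x \in xs).
  by rewrite exs rootZ // root_prod_XsubC.
have uxs : uniq xs.
  have sq x : ~~ (('X - x%:P) ^+ 2 %| \prod_(x <- xs) ('X - x%:P)).
    by have := sum_sqr_not_dvd_opoly n x 0; rewrite expr0n addr0 {1}exs dvdpZr.
  elim: (xs) sq => // x s IH sq /=; apply/andP; split.
    apply/negP => xs'; move: (sq x).
    rewrite big_cons expr2 dvdp_mul2l ?polyXsubC_eq0 //.
    by rewrite dvdp_XsubCl root_prod_XsubC xs'.
  apply: IH => y; apply: contra (sq y) => h.
  by rewrite big_cons dvdp_mull.
split=> //.
  have := size_opoly b a_gt0 n; rewrite exs size_scale // size_prod_XsubC.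
  by case.
move=> q rq; rewrite exs dvdpZl //.
by apply: uniq_roots_dvdp; rewrite ?uniq_rootsE.
Qed.

Lemma opoly_nearest_root n x0 : exists x, root (P n.+1) x /\
  forall y, root (P n.+1) y -> `|x - x0| <= `|y - x0|.
Proof.
have [xs [_ sxs rxs _]] := opoly_split n.+1.
case: (@arg_minP _ _ _ (ord0 : 'I_n.+1) xpredT
  (fun i => `|xs`_i - x0|)) => // i _ imin.
exists xs`_i; split; first by rewrite rxs mem_nth // sxs.
move=> y; rewrite rxs => /(nthP 0)[j]; rewrite sxs => ltj <-.
exact: (imin (Ordinal ltj)).
Qed.

(** Gauss quadrature, without naming its weights. Let ell x be the Lagrange
    polynomial at the zero x. The sum s of the q(x) (ell x)^2 agrees with q at
    all zeros, so q - s is P n times a polynomial of degree less than n, which L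
    annihilates. Thus L q = L s, a nonnegative combination of L ((ell x)^2). *)
Lemma functional_ge0_of_roots n (q : {poly R}) :
  (size q <= n + n)%N -> (forall x, root (P n) x -> 0 <= q.[x]) -> 0 <= L q.
Proof.
move=> sq q_ge0; have [xs [uxs sxs rxs dvdP]] := opoly_split n.
pose w x := P n %/ ('X - x%:P).
have wE x : x \in xs -> P n = w x * ('X - x%:P).
  by move=> xxs; rewrite divpK // dvdp_XsubCl rxs.
have sw x : x \in xs -> (size (w x)).+1 = n.+1.
  move=> xxs; rewrite -(size_opoly b a_gt0 n) (wE x xxs).
  rewrite size_Mmonic ?monicXsubC //.
    by rewrite size_XsubC addn2.
  apply: contraNneq (opoly_neq0 b a_gt0 n) => w0.
  by rewrite (wE x xxs) w0 mul0r.
pose ell x := (w x).[x]^-1 *: w x.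
pose s : {poly R} := \sum_(x <- xs) q.[x] *: ell x ^+ 2.
have s_xs y : y \in xs -> s.[y] = q.[y].
  move=> yxs; rewrite /s horner_sum (bigD1_seq y) //= big_seq_cond.
  rewrite big1 => [|x /andP[xxs xy]].
    rewrite addr0 hornerZ horner_exp hornerZ mulVf ?expr1n ?mulr1 //.
    by apply: opoly_simple_root; rewrite rxs.
  have /eqP : (P n).[y] = 0 by apply/rootP; rewrite rxs.
  rewrite (wE x xxs) hornerM mulf_eq0.
  rewrite hornerXsubC subr_eq0 [y == x]eq_sym (negbTE xy) orbF => /eqP wy.
  by rewrite hornerZ horner_exp hornerZ wy mulr0 expr0n mulr0.
have dvd : P n %| q - s.
  apply: dvdP; apply/allP => y yxs.
  by rewrite /root hornerD hornerN s_xs ?subrr.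
have ss : (size s <= n + n)%N.
  apply: (leq_trans (size_sum _ _ _)); apply/bigmax_leqP_seq => x xxs _.
  rewrite (leq_trans (size_scale_leq _ _)) // expr2.
  rewrite (leq_trans (size_polyMleq _ _)) //.
  have [sw'] := sw x xxs.
  have := size_scale_leq (w x).[x]^-1 (w x); rewrite sw' -/(ell x) => h.
  by rewrite (leq_trans (leq_pred _)) // leq_add.
have -> : q = s + P n * ((q - s) %/ P n) by rewrite mulrC divpK // subrKC.
rewrite linearD /= functional_opoly_orth ?addr0.
  rewrite linear_sum big_seq sumr_ge0 // => x xxs.
  by rewrite scalarZ mulr_ge0 // q_ge0 // rxs.
rewrite size_divp ?opoly_neq0 // size_opoly //= leq_subLR.
by rewrite (leq_trans (size_polyD _ _)) // size_polyN geq_max sq.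
Qed.

Lemma functional_mul_le (q r : {poly R}) :
  2 * `|L (q * r)| <= L (q ^+ 2) + L (r ^+ 2).
Proof.
have := L_sqr_ge0 (q + 1 *: r); have := L_sqr_ge0 (q + (-1) *: r).
rewrite !functional_sqrD sqrrN !expr1n.
move: (L (q * r)) (L (q ^+ 2)) (L (r ^+ 2)) => u v w.
by case: (ger0P u); lra.
Qed.

(** Integrate (y - x) q r = P n * r - P n.+1 * q: the second product is
    orthogonal, and r has degree n with the leading coefficient of P n.+1, which
    is that of P n divided by a n.+1. *)
Lemma opoly_succ_roots_gap n x y : root (P n) x -> root (P n.+1) y ->
  a n.+1 * (y - x) *
    L ((P n %/ ('X - x%:P)) * (P n.+1 %/ ('X - y%:P))) = 1.
Proof.
move=> rx ry; set q := P n %/ _; set r := P n.+1 %/ _.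
have eq : P n = q * ('X - x%:P) by rewrite divpK // dvdp_XsubCl.
have er : P n.+1 = r * ('X - y%:P) by rewrite divpK // dvdp_XsubCl.
have sq : (size q <= n)%N.
  by rewrite size_divp ?polyXsubC_eq0 // size_XsubC size_opoly // subn1.
have sr : (size r <= n.+1)%N.
  by rewrite size_divp ?polyXsubC_eq0 // size_XsubC size_opoly // subn1.
have an : a n.+1 != 0 by exact: lt0r_neq0.
have rn : r`_n = (P n.+1)`_n.+1.
  rewrite er mulrBr coefB coefMX coefMC /= (nth_default 0 sr).
  by rewrite mul0r subr0.
have e : (y - x) *: (q * r) = P n * r - P n.+1 * q.
  by rewrite eq er -mul_polyC rmorphB /=; ring.
have := congr1 L e; rewrite scalarZ linearB (functional_opolyM sr) rn.
rewrite functional_opoly_orth ?(leqW sq) // subr0 -mulrA => ->.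
rewrite mulrA lead_opolyS // divff //.
exact: lt0r_neq0 (coef_opoly_gt0 b a_gt0 n).
Qed.

End PositiveFunctional.

(** * Integration against the orthogonality measure *)

Section OrthogonalityMeasure.
Variables (R : realType) (a b : nat -> R).
Variable rho : probability (measurableTypeR R) R.
Hypothesis a_gt0 : forall n, 0 < a n.+1.
Hypothesis rho_orth : orthonormal_wrt rho (opoly a b).

Local Notation P := (opoly a b).

Lemma integrable_poly (q : {poly R}) :
  rho.-integrable setT (EFin \o horner q).
Proof.
apply: (opoly_span_ind (K := fun q => rho.-integrable setT (EFin \o horner q))
          (b := b) a_gt0) (leqnn (size q)).
  rewrite (_ : EFin \o _ = cst 0%E); first exact: integrable0.
  by apply/funext => x /=; rewrite horner0.
move=> c m r _ ir.
have im : rho.-integrable setT (EFin \o horner (P m)).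
  have [+ _] := rho_orth 0 m; congr (rho.-integrable _ _).
  by apply/funext => x /=; rewrite hornerC mul1r.
rewrite (_ : EFin \o _ =
  ((EFin \o horner r) \+ (fun x => c%:E * (EFin \o horner (P m)) x))%E).
  by apply: integrableD => //; exact: integrableZl.
by apply/funext => x /=; rewrite hornerD hornerZ EFinD EFinM.
Qed.

Definition poly_integral (q : {poly R}) : R := \int[rho]_(x in setT) q.[x].

Lemma poly_integral_scalar : scalar poly_integral.
Proof.
move=> c q r; rewrite /poly_integral.
rewrite -RintegralZl //; last exact: integrable_poly.
rewrite -RintegralD //; last 2 first.
- rewrite (_ : EFin \o _ = EFin \o horner (c *: q)).
    exact: integrable_poly.
  by apply/funext => x /=; rewrite hornerZ.
- exact: integrable_poly.
by apply: eq_Rintegral => x _; rewrite hornerD hornerZ.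
Qed.

(** The integral bundled as a linear form, so that the results on positive
    functionals apply. *)
Definition poly_functional : {scalar {poly R}} :=
  HB.pack_for {scalar {poly R}} poly_integral
    (GRing.isLinear.Build R {poly R} R *%R poly_integral poly_integral_scalar).

Local Notation L := poly_functional.

Lemma poly_integral_ge0 (q : {poly R}) : (forall x, 0 <= q.[x]) -> 0 <= L q.
Proof. by move=> q0; apply: Rintegral_ge0 => x _. Qed.

Lemma poly_integral_sqr_ge0 (q : {poly R}) : 0 <= L (q ^+ 2).
Proof. by apply: poly_integral_ge0 => x; rewrite horner_exp sqr_ge0. Qed.

Lemma poly_integral_orth m n : L (P m * P n) = (m == n)%:R.
Proof.
have [_ e] := rho_orth m n.
rewrite /= /poly_integral /Rintegral.
under eq_integral do rewrite hornerM.
by rewrite e.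
Qed.

(** This is how the support enters: an inequality between polynomials needs
    to be checked only away from a null set. *)
Lemma poly_integral_ge0_off_null (N : set (measurableTypeR R)) (q : {poly R}) :
  measurable N -> rho N = 0 -> (forall x, ~ N x -> 0 <= q.[x]) -> 0 <= L q.
Proof.
move=> mN N0 q0; rewrite /= /poly_integral /Rintegral.
rewrite (negligible_integral mN) //; last exact: integrable_poly.
by rewrite fine_ge0 // integral_ge0 // => x [_ Nx]; rewrite lee_fin q0.
Qed.

(** A Markov inequality, which turns positive mass near a support point into
    a lower bound for integrals. *)
Lemma markov_poly_integral (U : set (measurableTypeR R)) c (q : {poly R}) :
  measurable U -> (forall x, 0 <= q.[x]) -> (forall x, U x -> c <= q.[x]) ->
  c * fine (rho U) <= L q.
Proof.
move=> mU q0 cq; rewrite -Rintegral_cst // /= /poly_integral.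
have iq := integrable_poly q.
have iU : rho.-integrable U (EFin \o horner q) by exact: integrableS iq.
apply: (@le_trans _ _ (\int[rho]_(x in U) q.[x])).
  apply: le_Rintegral => //.
  exact: finite_measure_integrable_cst.
rewrite /Rintegral fine_le ?integrable_fin_num //.
apply: ge0_subset_integral => //; first by case/integrableP: iq.
by move=> x _; rewrite lee_fin.
Qed.

(** Division by X - w multiplies the norm in L^2(rho) by at most 1 / d when all
    points off some null set are at distance at least d from w; the identity
    opoly_succ_roots_gap then bounds |y - x| from below. *)
Lemma consecutive_roots_apart (U : set (measurableTypeR R)) d n x y :
  measurable U -> rho U = 0 -> 0 < d ->
  (forall t, ~ U t -> d <= `|t - x|) -> (forall t, ~ U t -> d <= `|t - y|) ->
  root (P n) x -> root (P n.+1) y -> d ^+ 2 <= a n.+1 * `|y - x|.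
Proof.
move=> mU U0 d0 dx dy rx ry.
have an : 0 < a n.+1 by [].
have := opoly_succ_roots_gap a_gt0 poly_integral_orth rx ry.
have bound k w : (forall t, ~ U t -> d <= `|t - w|) -> root (P k) w ->
    d ^+ 2 * L ((P k %/ ('X - w%:P)) ^+ 2) <= 1.
  move=> dw rw; set q := P k %/ _.
  have eq : P k = q * ('X - w%:P) by rewrite divpK // dvdp_XsubCl.
  have PP : L (P k * P k) = 1 by rewrite poly_integral_orth eqxx.
  rewrite -[leRHS]PP -scalarZ -subr_ge0 -linearB.
  apply: (poly_integral_ge0_off_null mU U0) => t Ut.
  rewrite eq -expr2 hornerD hornerN hornerZ !horner_exp hornerM hornerXsubC.
  rewrite exprMn [d ^+ 2 * _]mulrC -mulrBr mulr_ge0 ?sqr_ge0 // subr_ge0.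
  by rewrite -[leRHS]real_normK ?num_real // ler_sqr ?nnegrE ?(ltW d0) // dw.
have := bound _ _ dx rx; have := bound _ _ dy ry.
set q := P n %/ _; set r := P n.+1 %/ _ => hr hq.
(* |L (q r)| <= 1 / d^2, by 2 |q r| <= q^2 + r^2. *)
have := functional_mul_le poly_integral_sqr_ge0 q r.
move: (L (q * r)) (L (q ^+ 2)) (L (r ^+ 2)) hq hr => u v w hq hr h e.
have d2 : 0 < d ^+ 2 by rewrite exprn_gt0.
have : d ^+ 2 * `|u| <= 1.
  have := ler_wpM2l (ltW d2) h; lra.
have : a n.+1 * `|y - x| * `|u| = 1.
  by rewrite -{1}(gtr0_norm an) -!normrM e normr1.
have : 0 <= a n.+1 * `|y - x| by rewrite mulr_ge0 // ltW.
move: (a n.+1 * _) (d ^+ 2) d2 => D d2 d20 D0 De de.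
have u0 : 0 < `|u|.
  rewrite normr_gt0; apply: contra_eq_neq De => ->.
  by rewrite normr0 mulr0 eq_sym oner_eq0.
by rewrite -(ler_pM2r u0) De.
Qed.

(** If P n has no zero within e of x0, the quadrature sees
    g = T^2 - (X - x0)^2 only where g <= al, whereas rho has mass where
    g >= be > al; large powers of g tell the two apart. *)
Lemma supp_near_root A x0 e :
  (forall k, a k.+1 <= A) -> (forall k, `|b k.+1| <= A) ->
  supp rho x0 -> 0 < e ->
  \forall n \near \oo, exists2 x, root (P n) x & `|x - x0| < e.
Proof.
move=> aA bA suppx e0.
have A0 : 0 <= A by exact: le_trans (ltW (a_gt0 0)) (aA 0%N).
set U := ball x0 (e / 2).
have mU : measurable (U : set (measurableTypeR R)).
  by apply: open_measurable; exact: ball_open.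
have U0 : 0 < fine (rho U).
  apply: fine_gt0; rewrite suppx /=; last first.
    split; first exact: ball_open.
    by apply: ballxx; lra.
  by rewrite (le_lt_trans (probability_le1 _ _)) // ltry.
(* T exceeds the distance from x0 to any zero, so that g >= 0 at the zeros. *)
set T := 3 * A + `|x0| + e.
set al := T ^+ 2 - e ^+ 2; set be := T ^+ 2 - (e / 2) ^+ 2.
have T_gt : e <= T by rewrite /T lerDr addr_ge0 // mulr_ge0.
have al0 : 0 <= al by rewrite /al; nra.
have albe : al < be by rewrite /al /be; nra.
have be0 : 0 < be by lra.
have [k hk] : exists k, al ^+ (2 * k) < be ^+ (2 * k) * fine (rho U).
  have : `|(al / be) ^+ 2| < 1.
    rewrite ger0_norm ?sqr_ge0 // exprn_ilt1 //; last first.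
      by rewrite ltr_pdivrMr // mul1r.
    by rewrite divr_ge0 // ltW.
  move=> /(cvg_geometric 1) /cvgrPdist_lt /(_ _ U0) [k _ /(_ k (leqnn k))].
  rewrite /= sub0r normrN mul1r -exprM ger0_norm; last first.
    by rewrite exprn_ge0 // divr_ge0 // ltW.
  rewrite expr_div_n ltr_pdivrMr ?exprn_gt0 // => h.
  by exists k; rewrite mulrC.
exists (2 * k).+1 => // n /= kn.
apply: contrapT => noroot.
set g : {poly R} := (T ^+ 2)%:P - ('X - x0%:P) ^+ 2.
have gE t : g.[t] = T ^+ 2 - (t - x0) ^+ 2 by rewrite /g !hornerE.
have sg : (size g <= 3)%N.
  rewrite (leq_trans (size_polyD _ _)) // size_polyN size_exp_XsubC geq_max /=.
  by rewrite (leq_trans (size_polyC_leq1 _)).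
have : 0 <= L ((al ^+ (2 * k))%:P - g ^+ (2 * k)).
  apply: (functional_ge0_of_roots (n := n) a_gt0
    poly_integral_sqr_ge0 poly_integral_orth).
    rewrite (leq_trans (size_polyD _ _)) // size_polyN geq_max.
    rewrite (leq_trans (size_polyC_leq1 _)) /=; last by lia.
    rewrite (leq_trans (size_poly_exp_leq _ _)) //.
    have sg2 : ((size g).-1 * (2 * k) <= 2 * (2 * k))%N.
      by rewrite leq_mul2r; apply/orP; right; case: (size g) sg.
    rewrite (leq_trans _ (leq_add kn kn)) // addSn addnS ltnS leqW //.
    by rewrite (leq_trans sg2) // mul2n -addnn.
  move=> x rx; have xA := opoly_root_bound a_gt0 aA bA rx.
  have ex : e <= `|x - x0|.
    by rewrite leNgt; apply/negP => h; apply: noroot; exists x.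
  have xT : `|x - x0| <= T.
    by have := ler_normB x x0; rewrite /T; move: (ltW e0) xA; lra.
  have e2 : e ^+ 2 <= (x - x0) ^+ 2.
    by rewrite -[leRHS]real_normK ?num_real // ler_sqr ?nnegrE // ltW.
  have T2 : (x - x0) ^+ 2 <= T ^+ 2.
    rewrite -[leLHS]real_normK ?num_real // ler_sqr ?nnegrE //.
    exact: le_trans xT.
  rewrite hornerD hornerN hornerC horner_exp subr_ge0.
  by rewrite lerXn2r ?nnegrE // gE ?subr_ge0 // /al lerD2l lerN2.
have L1 : L 1 = 1 by have := poly_integral_orth 0 0; rewrite mulr1.
rewrite linearB -[X in L X - _]alg_polyC scalarZ L1 mulr1 subr_ge0.
apply/negP; rewrite -ltNge (lt_le_trans hk) //.
apply: markov_poly_integral => // x.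
  by rewrite horner_exp exprM exprn_ge0 // sqr_ge0.
rewrite /U /ball /= => xU.
have e2 : (x - x0) ^+ 2 <= (e / 2) ^+ 2.
  rewrite -[leLHS]real_normK ?num_real // ler_sqr ?nnegrE //; last by lra.
  by rewrite distrC ltW.
have beg : be <= g.[x] by rewrite gE /be lerD2l lerN2.
by rewrite horner_exp lerXn2r ?nnegrE ?(ltW be0) // (le_trans (ltW be0)).
Qed.

End OrthogonalityMeasure.

(** * Periodic coefficients and convergence in the complex plane *)

Lemma periodic_bounded (R : realType) (p : nat) (f : nat -> R) :
  (0 < p)%N -> (forall n, (0 < n)%N -> f (n + p)%N = f n) ->
  exists A, forall n, `|f n.+1| <= A.
Proof.
move=> p0 fp; exists (\sum_(i < p) `|f i.+1|) => n.
have -> : f n.+1 = f (n %% p).+1.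
  rewrite {1}(divn_eq n p); elim: (n %/ p)%N => [|k IH]; first by rewrite mul0n.
  by rewrite mulSn -addnA addnC -addSn fp.
rewrite (bigD1 (Ordinal (ltn_pmod n p0))) //= lerDl.
by rewrite sumr_ge0.
Qed.

Lemma normc_lt_ReIm (R : realType) (w : R[i]) (e : R) :
  `|w| < e%:C -> `|complex.Re w| < e /\ `|complex.Im w| < e.
Proof.
rewrite normc_def ltcR => h.
by split; apply: le_lt_trans h;
  rewrite -sqrtr_sqr ler_wsqrtr // ?lerDl ?lerDr sqr_ge0.
Qed.

Lemma cvg_complex_real (R : realType) (x : nat -> R) (l : R) :
  x n @[n --> \oo] --> l ->
  (((x n)%:C : R[i]^o) @[n --> \oo] --> (l%:C : R[i]^o)).
Proof.
move=> xl; apply/cvgrPdist_lt => -[e e'] /=.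
rewrite ltcE /= => /andP[/eqP-> e0].
move/cvgrPdist_lt: xl => /(_ e e0); apply: filterS => n.
by rewrite -rmorphB normc_def /= expr0n addr0 sqrtr_sqr -[_ +i* _]/(e%:C) ltcR.
Qed.

Theorem proposition2p7 (R : realType) (p : nat) (a b : nat -> R)
    (rho : probability (measurableTypeR R) R) (z0 : R[i]) :
  (0 < p)%N ->
  (forall n : nat, (0 < n)%N -> 0 < a n) ->
  (forall n : nat, (0 < n)%N -> a (n + p)%N = a n) ->
  (forall n : nat, (0 < n)%N -> b (n + p)%N = b n) ->
  orthonormal_wrt rho (opoly a b) ->
  (exists z : nat -> R[i],
     (forall n : nat, (0 < n)%N ->
        root (map_poly (real_complex R) (opoly a b n)) (z n)) /\
     (z n : R[i]^o) @[n --> \oo] --> (z0 : R[i]^o))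
  <-> (exists2 x : R, supp rho x & z0 = x%:C).
Proof.
move=> p0 a_gt0' a_per b_per rho_orth.
have a_gt0 n : 0 < a n.+1 by exact: a_gt0'.
have [A1 aA1] := periodic_bounded p0 a_per.
have [A2 bA2] := periodic_bounded p0 b_per.
pose A := Num.max A1 A2.
have aA k : a k.+1 <= A by rewrite le_max (le_trans (ler_norm _) (aA1 k)).
have bA k : `|b k.+1| <= A by rewrite le_max bA2 orbT.
have A0 : 0 < A by exact: lt_le_trans (aA 0%N).
pose Lge0 := poly_integral_sqr_ge0 a_gt0 rho_orth.
pose Lorth := poly_integral_orth a_gt0 rho_orth.
split=> [[z [rz zz0]]|[x0 suppx ->]]; last first.
  (* Nearest zeros: one sequence that works for every radius. *)
  pose z n := if n is m.+1 then
    projT1 (cid (opoly_nearest_root a_gt0 Lge0 Lorth m x0)) else 0.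
  exists (fun n => (z n)%:C); split=> [[//|n] _|].
    by rewrite fmorph_root /z; case: cid => x [].
  apply: cvg_complex_real; apply/cvgrPdist_lt => e e0.
  have := supp_near_root a_gt0 rho_orth aA bA suppx e0.
  move=> [N _ near_root]; exists N.+1 => // -[//|n] /= Nn.
  have [y ry yx] := near_root n.+1 (ltnW Nn).
  rewrite /z; case: cid => x [rx xmin] /=.
  by rewrite distrC (le_lt_trans (xmin _ ry)).
have near_z e : 0 < e -> exists N, forall n, (N <= n)%N ->
    `|complex.Re (z0 - z n)| < e /\ `|complex.Im (z0 - z n)| < e.
  move=> e0; have e0C : 0 < e%:C by rewrite ltcR.
  move/cvgrPdist_lt: zz0 => /(_ _ e0C)[N _ HN].
  by exists N => n Nn; apply: normc_lt_ReIm; exact: HN.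
have real_z n : complex.Im (z n.+1) = 0 /\
    root (opoly a b n.+1) (complex.Re (z n.+1)).
  exact: (opoly_root_real a_gt0 Lge0 Lorth) (rz n.+1 isT).
pose x0 := complex.Re z0; pose x n := complex.Re (z n).
have z0E : z0 = x0%:C.
  apply/eqP; rewrite eq_complex eqxx /=; apply/negPn/negP => v0.
  have v_gt0 : 0 < `|complex.Im z0| by rewrite normr_gt0.
  have [N /(_ N.+1 (leqnSn N))[_]] := near_z _ v_gt0.
  by rewrite raddfB /= (real_z N).1 subr0 ltxx.
exists x0 => //= U [oU Ux0].
rewrite lt_def measure_ge0 andbT; apply/eqP => U0.
have mU : measurable (U : set (measurableTypeR R)) by exact: open_measurable.
have /nbhs_ballP[d /= d0 dU] : nbhs x0 U by exact: open_nbhs_nbhs.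
(* The first bound keeps the zeros at distance d / 2 from the complement of U;
   the second makes two of them closer than (d / 2)^2 / A, which
   consecutive_roots_apart forbids. *)
pose e := Num.min (d / 2) ((d / 2) ^+ 2 / (4 * A)).
have e0 : 0 < e by rewrite lt_min !divr_gt0 ?exprn_gt0 ?mulr_gt0 // divr_gt0.
have [N HN] := near_z e e0.
have xe n : (N <= n)%N -> `|x0 - x n| < e by move=> /HN[+ _]; rewrite raddfB.
have far n : (N <= n)%N -> forall t, ~ U t -> d / 2 <= `|t - x n|.
  move=> /xe xn t Ut; have tx : d <= `|x0 - t|.
    by rewrite leNgt; apply/negP => h; apply: Ut; exact: dU.
  have := ler_distD (x n) x0 t; rewrite [`|t - _|]distrC.
  have : e <= d / 2 by rewrite ge_min lexx.
  lra.
have d20 : 0 < d / 2 by rewrite divr_gt0.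
have := consecutive_roots_apart a_gt0 rho_orth mU U0 d20
  (far N.+1 (leqnSn N)) (far N.+2 (leqW (leqnSn N)))
  (real_z N).2 (real_z N.+1).2.
have xx : `|x N.+2 - x N.+1| < 2 * e.
  have := ler_distD x0 (x N.+2) (x N.+1); rewrite [`|_ - x0|]distrC.
  by have := xe _ (leqnSn N); have := xe _ (leqW (leqnSn N)); lra.
have eA : 4 * A * e <= (d / 2) ^+ 2.
  by rewrite mulrC -ler_pdivlMr ?mulr_gt0 // ge_min lexx orbT.
have := aA N.+1; have := a_gt0 N.+1.
rewrite -/(x N.+1) -/(x N.+2).
have := normr_ge0 (x N.+2 - x N.+1).
have := exprn_gt0 2 d20.
nra.
Qed.
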